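(* Let $p>2$ be a prime and $\lambda$ an ordering of $\mathbb{F}_p\times\mathbb{F}_p$, and let $q_1,r_1,\sigma\in\mathrm{Aut}\,X^*$ be the associated automorphisms. The group $H=\langle q_1,r_1,\sigma\rangle$ is regular branch over its commutator subgroup $H'$.
   Context: Tree automorphisms. Let $p>2$ be a prime and $X=\{0,1,\dots,p-1\}$, identified with the field $\mathbb{F}_p$. The set $X^*$ of finite words over $X$ is a rooted $p$-ary tree (root the empty word; $w$ is joined to $wx$). For $g\in\mathrm{Aut}\,X^*$ and $v\in X^*$, the restriction $g|_v\in \mathrm{Aut}\,X^*$ is defined by $g(vw)=g(v)\,g|_v(w)$. Write $g=(g|_0,g|_1,\dots,g|_{p-1})\pi_g$, where $\pi_g$ is the permutation of $X$ induced by $g$ (omitted if trivial). Let $\sigma=(0,1,\dots,p-1)$ be the cyclic permutation $x\mapsto x+1$ of $X$; $\sigma$ also denotes the automorphism $(1,\dots,1)\sigma$. The automorphisms $q_i,r_i$. Let $\lambda=\{(\alpha_i,\beta_i): i=1,\dots,p^2\}$ be an ordering (enumeration without repetition) of all pairs in $\mathbb{F}_p\times\mathbb{F}_p$. Put $u_i=0$, $v_i=1$ if $\beta_i=0$, and $u_i=1$, $v_i=-\alpha_i/\beta_i$ if $\beta_i\neq 0$. Define $q_i,r_i\in\mathrm{Aut}\,X^*$ ($i=1,\dots,p^2$, indices taken modulo $p^2$) recursively by $$q_i=(q_{i+1},\sigma^{u_i},1,\dots,1),\qquad r_i=(r_{i+1},\sigma^{v_i},1,\dots,1).$$ Regular branch.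 A group $G$ acting on $X^*$ is regular branch over its subgroup $P$ if (1) $G$ acts transitively on each level $X^n$, $n\ge0$; (2) for some $k\ge 1$, $P$ geometrically contains the direct product of $|X|^k$ copies of $P$: for every family $(g_v)_{v\in X^k}$ of elements of $P$, the automorphism $g$ of $X^*$ that fixes $X^k$ pointwise and satisfies $g|_v=g_v$ for all $v\in X^k$ belongs to $P$; and (3) $P$ has finite index in $G$. *)

(* Defs.v *)
From HB Require Import structures.
From mathcomp Require Import all_boot all_fingroup all_algebra.
From mathcomp Require Import boolp classical_sets cardinality.

Set Implicit Arguments.
Unset Strict Implicit.
Unset Printing Implicit Defensive.

Import GRing.Theory.

Local Open Scope classical_set_scope.
Local Open Scope group_scope.

Section TreeAutomorphisms.
Variable X : finType.

Definition tree_adj (v w : seq X) : Prop :=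
  exists x, w = rcons v x \/ v = rcons w x.

Definition is_tree_aut (f : seq X -> seq X) : Prop :=
  [/\ bijective f, f [::] = [::]
    & forall v w, tree_adj (f v) (f w) <-> tree_adj v w].

Record tree_aut : Type := TreeAut {
  tree_aut_fun :> seq X -> seq X;
  tree_autP : is_tree_aut tree_aut_fun }.

Lemma tree_aut_ext (g h : tree_aut) : g =1 h -> g = h.
Proof.
case: g h => [f fP] [f' f'P] /= /funext eq_ff'.
by case: _ / eq_ff' in f'P *; rewrite (Prop_irrelevance fP f'P).
Qed.

Lemma tree_aut_rcons (f : seq X -> seq X) : is_tree_aut f ->
  forall w, size (f w) = size w /\
    forall x, exists y, f (rcons w x) = rcons (f w) y.
Proof.
case=> bij_f f0 fE; elim/last_ind => [|w z [szw IHw]].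
  split; first by rewrite f0.
  move=> x; have /fE [y []] : tree_adj [::] [:: x] by exists x; left.
    by exists y.
  by rewrite f0 => /(congr1 size); rewrite size_rcons.
have [y fwz] := IHw z; split; first by rewrite fwz !size_rcons szw.
move=> x.
have /fE [t []] : tree_adj (rcons w z) (rcons (rcons w z) x) by exists x; left.
  by exists t.
rewrite fwz => /rcons_inj [] /(bij_inj bij_f) /(congr1 size).
by rewrite !size_rcons => /eqP; rewrite -addn2 -{1}(addn0 (size w)) eqn_add2l.
Qed.

Lemma is_tree_aut_can (f g : seq X -> seq X) :
    cancel f g -> cancel g f -> f [::] = [::] ->
    (forall w x, exists y, f (rcons w x) = rcons (f w) y) ->
    (forall w x, exists y, g (rcons w x) = rcons (g w) y) ->
  is_tree_aut f.
Proof.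
have adj_homo h : (forall w x, exists y, h (rcons w x) = rcons (h w) y) ->
    forall v w, tree_adj v w -> tree_adj (h v) (h w).
  by move=> hE v w [x [->|->]]; [have [y ->] := hE v x | have [y ->] := hE w x];
    exists y; [left | right].
move=> fK gK f0 fE gE; split=> //; first by exists g.
move=> v w; split; last exact: adj_homo.
by move=> /(adj_homo _ gE); rewrite !fK.
Qed.

Lemma tree_aut_inv_subproof (g : tree_aut) :
  {h : seq X -> seq X | [/\ cancel g h, cancel h g & is_tree_aut h]}.
Proof.
apply: cid; have [[h gK hK] g0 gE] := tree_autP g; exists h; split=> //.
split; first by exists g.
  by rewrite -g0 gK.
by move=> v w; rewrite -gE !hK.
Qed.

Lemma tree_aut1_subproof : is_tree_aut id.
Proof. by split=> //; exists id. Qed.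

Lemma tree_aut_mul_subproof (g h : tree_aut) : is_tree_aut (g \o h).
Proof.
have [[bg g0 gE] [bh h0 hE]] := (tree_autP g, tree_autP h).
split; first exact: bij_comp.
  by rewrite /= h0 g0.
by move=> v w; rewrite /= gE hE.
Qed.

Definition tree_aut1 : tree_aut := TreeAut tree_aut1_subproof.
(* Automorphisms act from the left: (g * h) w = g (h w). *)
Definition tree_aut_mul (g h : tree_aut) : tree_aut :=
  TreeAut (tree_aut_mul_subproof g h).
Definition tree_aut_inv (g : tree_aut) : tree_aut :=
  TreeAut (let: And3 _ _ hP := svalP (tree_aut_inv_subproof g) in hP).

Lemma tree_aut_mulA : associative tree_aut_mul.
Proof. by move=> g h k; exact: tree_aut_ext. Qed.
Lemma tree_aut_mul1g : left_id tree_aut1 tree_aut_mul.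
Proof. by move=> g; exact: tree_aut_ext. Qed.
Lemma tree_aut_mulg1 : right_id tree_aut1 tree_aut_mul.
Proof. by move=> g; exact: tree_aut_ext. Qed.
Lemma tree_aut_mulVg : left_inverse tree_aut1 tree_aut_inv tree_aut_mul.
Proof.
move=> g; apply: tree_aut_ext => w /=.
by case: (tree_aut_inv_subproof g) => h [].
Qed.
Lemma tree_aut_mulgV : right_inverse tree_aut1 tree_aut_inv tree_aut_mul.
Proof.
move=> g; apply: tree_aut_ext => w /=.
by case: (tree_aut_inv_subproof g) => h [].
Qed.

HB.instance Definition _ := gen_eqMixin tree_aut.
HB.instance Definition _ := gen_choiceMixin tree_aut.
HB.instance Definition _ := isGroup.Build tree_aut tree_aut_mulA
  tree_aut_mul1g tree_aut_mulg1 tree_aut_mulVg tree_aut_mulgV.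

Lemma tree_aut1E w : (1 : tree_aut) w = w. Proof. by []. Qed.
Lemma tree_autM (g h : tree_aut) w : (g * h) w = g (h w). Proof. by []. Qed.
Lemma tree_autK (g : tree_aut) : cancel g g^-1.
Proof. by move=> w; rewrite -tree_autM mulVg. Qed.
Lemma tree_autVK (g : tree_aut) : cancel g^-1 g.
Proof. by move=> w; rewrite -tree_autM mulgV. Qed.

Lemma size_tree_aut (g : tree_aut) w : size (g w) = size w.
Proof. by case: (tree_aut_rcons (tree_autP g) w). Qed.

Definition restr_fun (g : tree_aut) (v w : seq X) : seq X :=
  drop (size v) (g (v ++ w)).

Lemma tree_aut_cat (g : tree_aut) v w : g (v ++ w) = g v ++ restr_fun g v w.
Proof.
suff [s gvw] : exists s, g (v ++ w) = g v ++ s.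
  by rewrite /restr_fun gvw drop_size_cat ?size_tree_aut.
elim/last_ind: w => [|w x [s IHw]]; first by exists [::]; rewrite !cats0.
have [_ /(_ x) [y]] := tree_aut_rcons (tree_autP g) (v ++ w).
by rewrite rcons_cat IHw => ->; exists (rcons s y); rewrite rcons_cat.
Qed.

Lemma restr_subproof (g : tree_aut) (v : seq X) : is_tree_aut (restr_fun g v).
Proof.
have funE (h : tree_aut) u w x :
    exists y, restr_fun h u (rcons w x) = rcons (restr_fun h u w) y.
  have [_ /(_ x) [y]] := tree_aut_rcons (tree_autP h) (u ++ w).
  rewrite rcons_cat !tree_aut_cat rcons_cat => /eqP.
  by rewrite eqseq_cat // => /andP[_ /eqP ->]; exists y.
apply: (@is_tree_aut_can _ (restr_fun g^-1 (g v))) => [w|w|||]; try exact: funE.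
- rewrite {1}/restr_fun -tree_aut_cat tree_autK size_tree_aut.
  by rewrite drop_size_cat.
- rewrite {1}/restr_fun.
  have -> : v ++ restr_fun g^-1 (g v) w = g^-1 (g v ++ w).
    by rewrite tree_aut_cat tree_autK.
  by rewrite tree_autVK drop_size_cat ?size_tree_aut.
- by rewrite /restr_fun cats0 drop_oversize ?size_tree_aut.
Qed.

Definition restr (g : tree_aut) (v : seq X) : tree_aut :=
  TreeAut (restr_subproof g v).

Lemma restrP (g : tree_aut) v w : g (v ++ w) = g v ++ restr g v w.
Proof. exact: tree_aut_cat. Qed.

Definition wreath_fun (g : X -> tree_aut) (pi : {perm X}) (w : seq X) : seq X :=
  if w is x :: w' then pi x :: g x w' else [::].

Lemma wreath_subproof g pi : is_tree_aut (wreath_fun g pi).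
Proof.
have funE h s w x :
    exists y, wreath_fun h s (rcons w x) = rcons (wreath_fun h s w) y.
  case: w => [|z w] /=; last first.
    have [_ /(_ x) [y ->]] := tree_aut_rcons (tree_autP (h z)) w.
    by exists y.
  by exists (s x); have [_ -> _] := tree_autP (h x).
apply: (@is_tree_aut_can _ (wreath_fun (fun x => (g (pi^-1 x))^-1) pi^-1)) =>
  [[|x w]|[|x w]|||] //=; try exact: funE.
- rewrite permK; congr (_ :: _); exact: tree_autK.
- rewrite permKV; congr (_ :: _); exact: tree_autVK.
Qed.

(* wreath g pi is (g_0, ..., g_{p-1}) pi, i.e. x w |-> pi(x) g_x(w). *)
Definition wreath (g : X -> tree_aut) (pi : {perm X}) : tree_aut :=
  TreeAut (wreath_subproof g pi).

Lemma restr_wreath g pi x : restr (wreath g pi) [:: x] = g x.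
Proof. by apply: tree_aut_ext => w; rewrite /= /restr_fun /= drop0. Qed.

End TreeAutomorphisms.

Section Subgroups.
Variable G : groupType.
Implicit Types S H P : set G.

Definition is_subgroup P : Prop := group_closed [in P].

Definition generated_subgroup S : set G := smallest is_subgroup S.

Definition commutator_subgroup H : set G :=
  generated_subgroup [set [~ x, y] | x in H & y in H].

Definition finite_index P H : Prop :=
  finite_set [set [set (x * y)%g | y in P] | x in H].

End Subgroups.

Section RegularBranch.
Variable X : finType.
Implicit Types G P : set (tree_aut X).

Definition level_transitive G : Prop :=
  forall (n : nat) (v w : n.-tuple X), exists2 g, G g & g v = w.

Definition geometrically_contains_copies k P : Prop :=
  forall gs : k.-tuple X -> tree_aut X, (forall v, P (gs v)) ->
  forall g : tree_aut X, (forall v : k.-tuple X, g v = v /\ restr g v = gs v) ->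
  P g.

(* The automorphism quantified over in geometrically_contains_copies exists
   and is unique. *)
Lemma level_family_exists k (gs : k.-tuple X -> tree_aut X) :
  exists! g : tree_aut X, forall v : k.-tuple X, g v = v /\ restr g v = gs v.
Proof.
pose F (hs : k.-tuple X -> tree_aut X) (w : seq X) :=
  if insub (take k w) is Some v then val v ++ hs v (drop k w) else w.
have F_cat hs (v : k.-tuple X) w : F hs (val v ++ w) = val v ++ hs v w.
  rewrite /F take_size_cat ?size_tuple // drop_size_cat ?size_tuple //.
  by rewrite valK.
have F_small hs w : size w < k -> F hs w = w.
  move=> ltwk; rewrite /F; case: insubP => // v /eqP szv _.
  by move: szv; rewrite take_oversize 1?ltnW // => szv; rewrite szv ltnn in ltwk.
have splitw w : k <= size w -> exists (v : k.-tuple X) u, w = val v ++ u.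
  move=> lekw; have szt : size (take k w) == k by rewrite size_takel.
  by exists (Tuple szt), (drop k w); rewrite /= cat_take_drop.
have F_rcons hs w x : exists y, F hs (rcons w x) = rcons (F hs w) y.
  have [/splitw [v [u ->]]|ltwk] := leqP k (size w).
    rewrite rcons_cat !F_cat.
    have [_ /(_ x) [y ->]] := tree_aut_rcons (tree_autP (hs v)) u.
    by exists y; rewrite rcons_cat.
  rewrite (F_small hs w) //; exists x.
  move: ltwk; rewrite leq_eqVlt => /orP[/eqP szk|ltwk]; last first.
    by rewrite F_small // size_rcons.
  have szr : size (rcons w x) == k by rewrite size_rcons szk.
  rewrite -[rcons w x]cats0 -[rcons w x]/(val (Tuple szr)) F_cat.
  by have [_ -> _] := tree_autP (hs (Tuple szr)).
have F_can (hs hs' : k.-tuple X -> tree_aut X) :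
    (forall v, cancel (hs v) (hs' v)) -> cancel (F hs) (F hs').
  move=> hK w; have [/splitw [v [u ->]]|ltwk] := leqP k (size w).
    by rewrite !F_cat hK.
  by rewrite !F_small.
have F_aut : is_tree_aut (F gs).
  apply: (@is_tree_aut_can _ _ (F (fun v => (gs v)^-1))) => //.
  - by apply: F_can => v; exact: tree_autK.
  - by apply: F_can => v; exact: tree_autVK.
  - have [/splitw [v [u Ev]]|] := leqP k (@size X [::]); last exact: F_small.
    have u0 : u = [::] by case: (val v) Ev => //; case: (u).
    by rewrite Ev F_cat u0; have [_ -> _] := tree_autP (gs v).
have nil0 (h : tree_aut X) : h [::] = [::] by have [] := tree_autP h.
exists (TreeAut F_aut); split=> [v|g gP].
  have Fv : F gs v = v by rewrite -{1}[val v]cats0 F_cat nil0 cats0.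
  split=> //; apply: tree_aut_ext => w /=.
  by rewrite /restr_fun /= F_cat drop_size_cat.
apply: tree_aut_ext => w /=.
have [/splitw [v [u ->]]|ltwk] := leqP k (size w).
  by have [gv gr] := gP v; rewrite F_cat restrP gv gr.
rewrite F_small //; case: w ltwk => [|x w] ltwk; first by rewrite nil0.
have szt : size ((x :: w) ++ nseq (k - (size w).+1) x) == k.
  by rewrite size_cat size_nseq subnKC // ltnW.
have [+ _] := gP (Tuple szt); rewrite /tval restrP => /eqP.
by rewrite eqseq_cat ?size_tree_aut // => /andP[/eqP].
Qed.

Definition regular_branch G P : Prop :=
  [/\ is_subgroup G /\ is_subgroup P,
      P `<=` G,
      level_transitive G,
      exists2 k : nat, (0 < k)%N & geometrically_contains_copies k P
    & finite_index P G].

End RegularBranch.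

Section Generators.
Variable p : nat.

Notation X := 'F_p.

Definition sigma_perm : {perm X} := perm (@addIr X 1%R).

Lemma sigma_permE x : sigma_perm x = (x + 1)%R.
Proof. exact: permE. Qed.

Definition sigma : tree_aut X := wreath (fun=> 1) sigma_perm.

(* spine_fun a i is the action on words of s_i, where
   s_j = (s_{j+1}, sigma^(a j), 1, ..., 1) for all j; see spineE. *)
Fixpoint spine_fun (a : 'Z_(p ^ 2) -> 'F_p) (i : 'Z_(p ^ 2)) (w : seq X)
    {struct w} : seq X :=
  if w is x :: w' then
    if x == 0%R then x :: spine_fun a (i + 1)%R w'
    else if x == 1%R then x :: (sigma ^+ a i) w'
    else w
  else [::].

Lemma spine_subproof a i : is_tree_aut (spine_fun a i).
Proof.
pose fix inv_fun (i : 'Z_(p ^ 2)) (w : seq X) {struct w} : seq X :=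
  if w is x :: w' then
    if x == 0%R then x :: inv_fun (i + 1)%R w'
    else if x == 1%R then x :: (sigma ^- a i) w'
    else w
  else [::].
have rc (h : tree_aut X) w x : exists y, h (rcons w x) = rcons (h w) y.
  by have [_] := tree_aut_rcons (tree_autP h) w; apply.
have nil0 (h : tree_aut X) : h [::] = [::] by have [] := tree_autP h.
apply: (@is_tree_aut_can _ _ (inv_fun i)) => //.
- move=> w; elim: w i => //= x w IHw i.
  have [x0|x0] := boolP (x == 0%R); first by rewrite /= x0 IHw.
  have [x1|x1] := boolP (x == 1%R); last by rewrite /= (negbTE x0) (negbTE x1).
  rewrite /= (negbTE x0) x1; congr (_ :: _); exact: tree_autK.
- move=> w; elim: w i => //= x w IHw i.
  have [x0|x0] := boolP (x == 0%R); first by rewrite /= x0 IHw.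
  have [x1|x1] := boolP (x == 1%R); last by rewrite /= (negbTE x0) (negbTE x1).
  rewrite /= (negbTE x0) x1; congr (_ :: _); exact: tree_autVK.
- move=> w x; elim: w i => [|z w IHw] i /=.
    exists x; case: eqP => // _; case: eqP => // _.
    by congr (_ :: _); exact: (nil0 (sigma ^+ a i)).
  case: eqP => _; first by have [y ->] := IHw (i + 1)%R; exists y.
  case: eqP => _; last by exists x.
  by have [y ->] := rc (sigma ^+ a i) w x; exists y.
- move=> w x; elim: w i => [|z w IHw] i /=.
    exists x; case: eqP => // _; case: eqP => // _.
    by congr (_ :: _); exact: (nil0 (sigma ^- a i)).
  case: eqP => _; first by have [y ->] := IHw (i + 1)%R; exists y.
  case: eqP => _; last by exists x.
  have [y E] := rc (sigma ^- a i) w x; exists y.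
  by rewrite /=; congr (_ :: _); exact: E.
Qed.

Definition spine (a : 'Z_(p ^ 2) -> 'F_p) (i : 'Z_(p ^ 2)) : tree_aut X :=
  TreeAut (spine_subproof a i).

Lemma spineE a i :
  spine a i = wreath (fun x => if x == 0%R then spine a (i + 1)%R
                               else if x == 1%R then sigma ^+ a i
                               else 1) 1.
Proof.
apply: tree_aut_ext => -[|x w] //=; rewrite perm1.
by case: eqP => // _; case: eqP.
Qed.

(* The enumeration is indexed by the residues modulo p ^ 2: the index 1 is the
   first one and the index p ^ 2 is the residue 0. *)
Variable lambda : 'Z_(p ^ 2) -> 'F_p * 'F_p.

Definition u_exp (i : 'Z_(p ^ 2)) : 'F_p :=
  if (lambda i).2 == 0%R then 0%R else 1%R.

Definition v_exp (i : 'Z_(p ^ 2)) : 'F_p :=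
  if (lambda i).2 == 0%R then 1%R else (- ((lambda i).1 / (lambda i).2))%R.

Definition q_aut : 'Z_(p ^ 2) -> tree_aut X := spine u_exp.
Definition r_aut : 'Z_(p ^ 2) -> tree_aut X := spine v_exp.

Definition H_group : set (tree_aut X) :=
  generated_subgroup [set q_aut 1%R; r_aut 1%R; sigma].

End Generators.

(* Main.v *)
Require Import Defs.
From mathcomp Require Import all_boot all_fingroup all_algebra.
From mathcomp Require Import boolp classical_sets cardinality.

(* Since p > 2, the supports of a spine generator and of a sigma-conjugate of
   another one meet on the first level only at the letter 0. As u_i = 1 or
   v_i = 1, the commutators of such elements of H_i = <q_i, r_i, sigma> are the
   ([x, y], 1, ..., 1) for x, y among the generators of H_(i+1). The first-level
   stabilizer of H_i projects onto H_(i+1) at the letter 0, so H_i' contains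
   H_(i+1)' x 1 x ... x 1, hence, conjugating by sigma, H_(i+1)' x ... x
   H_(i+1)'. Going down p^2 levels brings the index back to i. The same
   projection gives level transitivity by induction, and H_i / H_i' is finite
   as it is abelian and generated by three elements of order dividing p. *)

Set Implicit Arguments.
Unset Strict Implicit.
Unset Printing Implicit Defensive.

Import GRing.Theory.

Local Open Scope classical_set_scope.
Local Open Scope group_scope.

(** * Subgroups as sets, and commutators of generated subgroups *)

Section SubgroupTheory.
Variable G : groupType.
Implicit Types (S P N : set G) (x y z : G).

Lemma is_subgroupP P :
  is_subgroup P <-> P 1 /\ forall x y, P x -> P y -> P (x * y^-1).
Proof.
rewrite /is_subgroup /group_closed unfold_in /= in_setE.
split=> -[P1 PV]; split=> // x y.
  by move=> Px Py; have := PV x y; rewrite !unfold_in /= !in_setE; apply.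
by rewrite !unfold_in /= !in_setE; exact: PV.
Qed.

Lemma subgroup1 P : is_subgroup P -> P 1.
Proof. by case/is_subgroupP. Qed.

Lemma subgroupV P x : is_subgroup P -> P x -> P x^-1.
Proof. by case/is_subgroupP => P1 PV Px; rewrite -(mul1g x^-1); apply: PV. Qed.

Lemma subgroupM P x y : is_subgroup P -> P x -> P y -> P (x * y).
Proof.
move=> sP Px Py; rewrite -(invgK y); case/is_subgroupP: (sP) => _; apply=> //.
exact: subgroupV.
Qed.

Lemma subgroupX P x n : is_subgroup P -> P x -> P (x ^+ n).
Proof.
move=> sP Px; elim: n => [|n IHn]; first exact: subgroup1.
by rewrite expgS; apply: subgroupM.
Qed.

Lemma subgroupJ P x y : is_subgroup P -> P x -> P y -> P (x ^ y).
Proof.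
by move=> sP Px Py; do ![apply: subgroupM => //]; apply: subgroupV.
Qed.

Lemma subgroupR P x y : is_subgroup P -> P x -> P y -> P [~ x, y].
Proof.
by move=> sP Px Py; apply: subgroupM; [|apply: subgroupV|apply: subgroupJ].
Qed.

Lemma is_subgroup_generated S : is_subgroup (generated_subgroup S).
Proof.
apply/is_subgroupP; split=> [P [sP _]|x y Sx Sy P SP]; first exact: subgroup1.
have sP := SP.1; apply: subgroupM => //; first exact: Sx.
by apply: subgroupV => //; exact: Sy.
Qed.

Lemma generated_subgroup_min S P :
  is_subgroup P -> S `<=` P -> generated_subgroup S `<=` P.
Proof. exact: smallest_sub. Qed.

Lemma sub_generated_subgroup S : S `<=` generated_subgroup S.
Proof. exact: sub_gen_smallest. Qed.

Lemma invg_commg x y : [~ x, y]^-1 = [~ y, x].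
Proof. by rewrite !commgEl !conjgE !invgM !invgK !mulgA. Qed.

Lemma commMg x y z : [~ x * y, z] = [~ x, z] ^ y * [~ y, z].
Proof. by rewrite !commgEl !conjgE !invgM !mulgA !mulgK. Qed.

(** For fixed [z], the identity [commMg] makes the [x] with [[~ x, z]] in [N] a subgroup. Using this
    in each argument, with an inversion to swap the two, reduces everything to commutators of
    generators. *)
Lemma commg_generated S N : is_subgroup N ->
    (forall c x, N c -> generated_subgroup S x -> N (c ^ x)) ->
    (forall s t, S s -> S t -> N [~ s, t]) ->
  forall x y, generated_subgroup S x -> generated_subgroup S y -> N [~ x, y].
Proof.
move=> sN NJ NS; have sS := is_subgroup_generated S.
have left_ind z : (forall s, S s -> N [~ s, z]) ->
    forall x, generated_subgroup S x -> N [~ x, z].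
  move=> Nz x Sx.
  suff /(_ x Sx)[] : generated_subgroup S `<=`
    [set y | generated_subgroup S y /\ N [~ y, z]] by [].
  apply: generated_subgroup_min => [|s Ss]; last first.
    by split; [exact: sub_generated_subgroup | exact: Nz].
  apply/is_subgroupP; split=> [|u v [Su Nu] [Sv Nv]].
    by split; [exact: subgroup1 | rewrite comm1g; exact: subgroup1].
  have Sv' := subgroupV sS Sv.
  split; first exact: (subgroupM sS).
  rewrite commMg; apply: subgroupM => //; first exact: NJ.
  (* Expanding the trivial commutator [[~ v * v^-1, z]] expresses [[~ v^-1, z]] as the inverse of a
     conjugate of [[~ v, z]]. *)
  have := commMg v v^-1 z; rewrite mulgV comm1g => /esym/(canRL (mulKg _)).
  by rewrite mulg1 => ->; apply: subgroupV => //; apply: NJ.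
move=> x y Sx Sy; apply: (left_ind _ _ _ Sx) => s Ss; rewrite -invg_commg.
by apply: subgroupV => //; apply: (left_ind _ _ _ Sy) => t St; apply: NS.
Qed.

End SubgroupTheory.

(** * The derived subgroup and finiteness of the abelianization *)

Section CommutatorSubgroup.
Variables (G : groupType) (H : set G).
Hypothesis sH : is_subgroup H.
Local Notation D := (commutator_subgroup H).

Let sD : is_subgroup D := is_subgroup_generated _.

Lemma commutator_subgroup_sub : D `<=` H.
Proof.
apply: (generated_subgroup_min sH) => // _ [x Hx [y Hy <-]].
exact: subgroupR.
Qed.

Lemma mem_commutator_subgroup x y : H x -> H y -> D [~ x, y].
Proof.
by move=> Hx Hy; apply: sub_generated_subgroup; exists x => //; exists y.
Qed.

Lemma commutator_subgroupJ c x : D c -> H x -> D (c ^ x).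
Proof.
move=> Dc Hx; have -> : c ^ x = c * [~ c, x] by rewrite commgEl mulKVg.
apply: (subgroupM sD) => //; apply: mem_commutator_subgroup => //.
exact: commutator_subgroup_sub.
Qed.

(** Equality in the abelianization, expressed on representatives: [x] and [y] have the same left
    coset of [D]. *)
Definition comm_cong x y := D (x^-1 * y).

Lemma comm_congxx x : comm_cong x x.
Proof. by rewrite /comm_cong mulVg; exact: subgroup1. Qed.

Lemma comm_cong_trans y x z :
  comm_cong x y -> comm_cong y z -> comm_cong x z.
Proof. by move=> xy yz; have := subgroupM sD xy yz; rewrite !mulgA mulgK. Qed.

(** The quotient [(x * x')^-1 * (y * y')] equals [(x^-1 * y) ^ x' * (x'^-1 * y')], and [D] is stable
    under conjugation by [x']. *)
Lemma comm_congM x x' y y' : H x' ->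
  comm_cong x y -> comm_cong x' y' -> comm_cong (x * x') (y * y').
Proof.
move=> Hx' xy xy'; have := subgroupM sD (commutator_subgroupJ xy Hx') xy'.
by rewrite /comm_cong conjgE invgM !mulgA mulgK.
Qed.

Lemma comm_congV x y : H x -> comm_cong x y -> comm_cong x^-1 y^-1.
Proof.
move=> Hx xy.
have := commutator_subgroupJ (subgroupV sD xy) (subgroupV sH Hx).
by rewrite /comm_cong conjgE invgM !invgK !mulgA mulgK.
Qed.

Lemma comm_congC x y : H x -> H y -> comm_cong (x * y) (y * x).
Proof.
move=> Hx Hy; have := mem_commutator_subgroup Hy Hx.
by rewrite /comm_cong commgEl conjgE invgM !mulgA.
Qed.

Lemma comm_cong_coset x y : comm_cong x y ->
  [set x * z | z in D] = [set y * z | z in D].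
Proof.
move=> xy; apply/seteqP; split=> _ [z Dz <-].
  exists ((x^-1 * y)^-1 * z); last by rewrite invgM invgK !mulgA mulgV mul1g.
  by apply: (subgroupM sD) => //; apply: (subgroupV sD).
exists (x^-1 * y * z); first exact: (subgroupM sD).
by rewrite !mulgA mulgV mul1g.
Qed.

End CommutatorSubgroup.

(* Modulo the commutator subgroup, every element is a product of powers
   t i ^+ f i with exponents f i < n. *)
Lemma finite_index_commutator (G : groupType) k (t : 'I_k -> G) n :
    (0 < n)%N -> (forall i, t i ^+ n = 1) ->
  finite_index (commutator_subgroup (generated_subgroup (range t)))
    (generated_subgroup (range t)).
Proof.
move=> n_gt0 tn; set H := generated_subgroup _; set D := commutator_subgroup H.
have sH : is_subgroup H := is_subgroup_generated _.
have Ht i : H (t i) by apply: sub_generated_subgroup; exists i.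
pose W (f : 'I_k -> nat) := \prod_(i < k) t i ^+ f i.
have HW f : H (W f).
  rewrite /W; elim/big_ind: _ => [|x y|i _].
  - exact: (subgroup1 sH).
  - exact: (subgroupM sH).
  - exact: (subgroupX _ sH).
have cong0 x : comm_cong H x x by exact: comm_congxx.
have WD f g : comm_cong H (W f * W g) (W (fun i => f i + g i)%N).
  (* Membership in [H] is carried through the induction, since commuting factors modulo [D] requires
     it. *)
  suff [] : [/\ H (W f), H (W g)
      & comm_cong H (W f * W g) (W (fun i => f i + g i)%N)] by [].
  rewrite /W; elim/big_rec3: _ => [|i x y z _ [Hx Hy xyz]].
    by rewrite mulg1; split=> //; exact: (subgroup1 sH).
  have [Hf Hg] := (subgroupX (f i) sH (Ht i), subgroupX (g i) sH (Ht i)).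
  split; try exact: (subgroupM sH).
  rewrite expgnDr.
  apply: (@comm_cong_trans _ _ (t i ^+ f i * t i ^+ g i * (z * y))); last first.
    by apply: comm_congM => //; exact: (subgroupM sH).
  rewrite -!mulgA; apply: comm_congM => //.
    by do 2![apply: (subgroupM sH) => //].
  rewrite !mulgA; apply: comm_congM => //; exact: comm_congC.
have Wmod f : W f = W (fun i => f i %% n)%N.
  apply: eq_bigr => i _.
  by rewrite {1}(divn_eq (f i) n) expgnDr mulnC expgnA tn expg1n mul1g.
(* The factor [n.-1] plays the role of -1 modulo [n] and keeps the exponents natural. *)
have WV f : comm_cong H (W f)^-1 (W (fun i => n.-1 * f i)%N).
  have := WD f (fun i => n.-1 * f i)%N; rewrite [X in comm_cong _ _ X]Wmod.
  have -> : W (fun i => (f i + n.-1 * f i) %% n)%N = 1.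
    rewrite /W big1 // => i _.
    by rewrite -mulSn prednK // modnMr.
  rewrite {1}/comm_cong mulg1 => DW; rewrite /comm_cong invgK.
  by rewrite -[X in _ X]invgK; apply: subgroupV DW;
    apply: is_subgroup_generated.
have HE x : H x -> exists f, comm_cong H x (W f).
  move=> Hx; suff /(_ x Hx)[] : H `<=`
    [set y | H y /\ exists f, comm_cong H y (W f)] by [].
  apply: generated_subgroup_min => [|_ [i _ <-]]; last first.
    split; first exact: Ht.
    exists (fun j => (j == i)%N).
    have -> : W (fun j => (j == i)%N) = t i; last exact: cong0.
    rewrite /W; under eq_bigr => j _ do rewrite expgb.
    by rewrite -big_mkcond big_pred1_eq.
  apply/is_subgroupP; split.
    split; first exact: (subgroup1 sH).
    by exists (fun=> 0%N); rewrite /W big1.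
  move=> y z [Hy [f yf]] [Hz [g zg]]; split.
    by apply: (subgroupM sH) => //; apply: (subgroupV sH).
  exists (fun i => f i + n.-1 * g i)%N; apply: comm_cong_trans (WD _ _).
  apply: comm_congM => //; first exact: (subgroupV sH).
  by apply: comm_cong_trans (WV g); apply: comm_congV.
apply: (@sub_finite_set _ _ [set [set (W (fun i => val (f i)) * y)%g | y in D] |
  f in [set: {ffun 'I_k -> 'I_n}]]); last first.
  by apply: finite_image; exact: finite_finset.
move=> _ [x /HE [f xf] <-].
exists [ffun i => Ordinal (ltn_pmod (f i) n_gt0)] => //.
rewrite (comm_cong_coset xf) (Wmod f); congr image; apply/funext => y.
by congr (_ * y); apply: eq_bigr => i _; rewrite ffunE.
Qed.

(** * Coordinatewise computation in the first-level stabilizer *)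

Section Wreath.
Variable X : finType.
Implicit Types (f g : X -> tree_aut X) (h : tree_aut X).

Lemma wreath1M f g : wreath f 1 * wreath g 1 = wreath (fun x => f x * g x) 1.
Proof. by apply: tree_aut_ext => -[|x w] //=; rewrite !perm1. Qed.

Lemma wreath11 f : (forall x, f x = 1) -> wreath f 1 = 1.
Proof.
by move=> f1; apply: tree_aut_ext => -[|x w] //=; rewrite perm1 f1.
Qed.

Lemma wreath1V f : (wreath f 1)^-1 = wreath (fun x => (f x)^-1) 1.
Proof.
apply: (mulgI (wreath f 1)); rewrite mulgV wreath1M wreath11 // => x.
exact: mulgV.
Qed.

Lemma wreath1R f g :
  [~ wreath f 1, wreath g 1] = wreath (fun x => [~ f x, g x]) 1.
Proof. by rewrite commgEl conjgE !wreath1V !wreath1M. Qed.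

Lemma wreath1X f n : wreath f 1 ^+ n = wreath (fun x => f x ^+ n) 1.
Proof.
elim: n => [|n IHn]; first by rewrite [RHS]wreath11.
by rewrite expgS IHn wreath1M; congr wreath; apply/funext => x; rewrite expgS.
Qed.

Lemma eq_wreath f g s : f =1 g -> wreath f s = wreath g s.
Proof. by move=> /funext ->. Qed.

Lemma wreath1_restr h : (forall x, h [:: x] = [:: x]) ->
  h = wreath (fun x => restr h [:: x]) 1.
Proof.
move=> hx; apply: tree_aut_ext => -[|x w] /=.
  by have [] := tree_autP h.
by rewrite perm1 -[x :: w]cat1s restrP hx.
Qed.

Lemma restr_cat h u v : restr h (u ++ v) = restr (restr h u) v.
Proof.
apply: tree_aut_ext => w.
by rewrite /= /restr_fun /= /restr_fun drop_drop size_cat addnC catA.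
Qed.

Definition at_letter (x : X) (c : tree_aut X) :=
  wreath (fun y => if y == x then c else 1) 1.

Lemma wreath1_mem (P : set (tree_aut X)) f : is_subgroup P ->
  (forall x, P (at_letter x (f x))) -> P (wreath f 1).
Proof.
move=> sP Pf.
(* The coordinates are multiplied in one letter at a time; without repetitions, each [f y] enters
   exactly once. *)
suff Ps s : uniq s -> P (wreath (fun y => if y \in s then f y else 1) 1).
  rewrite (@eq_wreath _ (fun y => if y \in enum X then f y else 1)) => [|x].
    by apply: Ps; exact: enum_uniq.
  by rewrite mem_enum.
elim: s => [_|x s IHs /= /andP[xs us]].
  by rewrite wreath11 //; exact: subgroup1.
have := subgroupM sP (Pf x) (IHs us); rewrite wreath1M.
rewrite (@eq_wreath _ (fun y => if y \in x :: s then f y else 1)) // => y.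
rewrite inE; case: eqP => [->|_] /=; last by rewrite mul1g.
by rewrite (negbTE xs) mulg1.
Qed.

End Wreath.

(** * Spine automorphisms and the groups they generate with sigma *)

Section Spine.
Variable p : nat.
Hypotheses (p_prime : prime p) (p_gt2 : (2 < p)%N).
Notation X := 'F_p.
Notation sigma := (sigma p).
Notation spine := (@spine p).

Lemma sigmaX_cons n (x : X) w : (sigma ^+ n) (x :: w) = (x + n%:R)%R :: w.
Proof.
elim: n x w => [|n IHn] x w; first by rewrite addr0.
by rewrite expgS tree_autM IHn /= sigma_permE -addrA natr1.
Qed.

Lemma sigmaXp : sigma ^+ p = 1.
Proof.
apply: tree_aut_ext => -[|x w]; first by have [] := tree_autP (sigma ^+ p).
by rewrite sigmaX_cons pchar_Fp_0 // addr0.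
Qed.

(** Automorphisms act from the left, so the conjugate applies [sigma ^+ n] first and reads the
    coordinate at [x + n]. *)
Lemma wreath1J_sigmaX f n :
  (wreath f 1) ^ (sigma ^+ n) = wreath (fun x : X => f (x + n%:R)%R) 1.
Proof.
apply: (mulgI (sigma ^+ n)); rewrite conjgE mulVKg.
apply: tree_aut_ext => -[|x w]; rewrite !tree_autM.
  by have [_ + _] := tree_autP (sigma ^+ n) => ->.
by rewrite sigmaX_cons /= !perm1 sigmaX_cons.
Qed.

Lemma at_letterJ_sigmaX (c : tree_aut X) n x :
  at_letter x c ^ (sigma ^+ n) = at_letter (x - n%:R)%R c.
Proof.
by rewrite wreath1J_sigmaX; apply: eq_wreath => y;
  rewrite [in RHS]eq_sym subr_eq eq_sym.
Qed.

(** Induction on the word for all [i] at once: the coordinates of the power are 1 or p-th powers of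
    the next spine or of a power of [sigma]. *)
Lemma spineXp a i : spine a i ^+ p = 1.
Proof.
apply: tree_aut_ext => w; elim: w i => [|x w IHw] i.
  by have [] := tree_autP (spine a i ^+ p).
rewrite spineE wreath1X /= perm1.
case: ifP => [_|_]; first by rewrite IHw.
case: ifP => [_|_]; last by rewrite expg1n.
by rewrite -expgnA mulnC expgnA sigmaXp expg1n.
Qed.

Variables a b : 'Z_(p ^ 2) -> 'F_p.

(** The group H_i for every starting index, as passing to the letter 0 replaces [i] by [i + 1]. *)
Definition spine_group i : set (tree_aut X) :=
  generated_subgroup [set spine a i; spine b i; sigma].

Let sH i : is_subgroup (spine_group i) := is_subgroup_generated _.

Lemma spine_group_genl i : spine_group i (spine a i).
Proof. by apply: sub_generated_subgroup; left; left. Qed.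

Lemma spine_group_genr i : spine_group i (spine b i).
Proof. by apply: sub_generated_subgroup; left; right. Qed.

Lemma spine_group_sigma i : spine_group i sigma.
Proof. by apply: sub_generated_subgroup; right. Qed.

Arguments spine_group_genl : clear implicits.
Arguments spine_group_genr : clear implicits.
Arguments spine_group_sigma : clear implicits.

Lemma finite_index_spine_group i :
  finite_index (commutator_subgroup (spine_group i)) (spine_group i).
Proof.
have -> : spine_group i = generated_subgroup
    (range (tnth [tuple spine a i; spine b i; sigma])).
  congr generated_subgroup; apply/seteqP; split.
    move=> _ [[->|->]|->]; [exists ord0 | exists 1%R | exists (inord 2)] => //.
    by rewrite (tnth_nth 1) /= inordK.
  move=> _ [[[|[|[|//]]] lti] _ <-]; rewrite (tnth_nth 1) /=.
  - by left; left.
  - by left; right.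
  - by right.
apply: (@finite_index_commutator _ _ _ p); first exact: prime_gt0.
case=> [[|[|[|//]]] lti]; rewrite (tnth_nth 1) /=.
- exact: spineXp.
- exact: spineXp.
- exact: sigmaXp.
Qed.

(** * Passing between consecutive indices through the letter 0 *)

Hypothesis a1b1 : forall i, a i = 1%R \/ b i = 1%R.

(** Here p > 2 enters: -1 = 1 would make p divide 2. *)
Lemma letterN1_neq : (-1 != 0 :> X)%R /\ (-1 != 1 :> X)%R.
Proof.
split; first by rewrite oppr_eq0 oner_neq0.
rewrite eq_sym -subr_eq0 opprK -[(1 + 1)%R]/(2%:R)%R.
rewrite -(dvdn_pcharf (pchar_Fp p_prime)).
by apply/negP => /(dvdn_leq (ltn0Sn 1)); rewrite leqNgt p_gt2.
Qed.

(* The conjugate by sigma of the generator with exponent 1: away from the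
   letter 0 its support is disjoint from that of the spines, as -1 is neither
   0 nor 1. *)
Lemma spine_group_sigma_lift i : exists g : X -> tree_aut X,
  [/\ spine_group i (wreath g 1), g 0%R = sigma
    & forall x, x != 0%R -> x != (-1)%R -> g x = 1].
Proof.
have [n0 _] := letterN1_neq.
have lift c : spine_group i (spine c i) -> c i = 1%R ->
    exists g : X -> tree_aut X, [/\ spine_group i (wreath g 1), g 0%R = sigma
    & forall x, x != 0%R -> x != (-1)%R -> g x = 1].
  move=> Hc c1; have Hc' := subgroupJ (sH i) Hc (spine_group_sigma i).
  rewrite spineE -[sigma]expg1 wreath1J_sigmaX in Hc'.
  exists (fun x => if x == (-1)%R then spine c (i + 1)%R
                   else if x == 0%R then sigma else 1).
  split; last by move=> x /negbTE-> /negbTE->.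
    move: Hc'; rewrite (@eq_wreath _ _ (fun x => if x == (-1)%R
      then spine c (i + 1)%R else if x == 0%R then sigma else 1)) // => x.
    rewrite mulr1n addr_eq0 -[(x + 1 == 1)%R]subr_eq0 addrK.
    by rewrite c1 expg1.
  by rewrite eq_sym (negbTE n0) eqxx.
by have [/lift|/lift] := a1b1 i; apply;
  [exact: spine_group_genl | exact: spine_group_genr].
Qed.

(** The restrictions at 0 of elements of the first-level stabilizer form a subgroup. It contains the
    two spines of index [i + 1] by their recursion, and [sigma] by [spine_group_sigma_lift]. *)
Lemma spine_group_lift i h : spine_group (i + 1)%R h ->
  exists2 g : X -> tree_aut X, spine_group i (wreath g 1) & g 0%R = h.
Proof.
move=> Hh; suff /(_ h Hh) : spine_group (i + 1)%R `<=` [set k |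
  exists2 g : X -> tree_aut X, spine_group i (wreath g 1) & g 0%R = k] by [].
apply: generated_subgroup_min => [|_ [[->|->]|->]].
- apply/is_subgroupP; split=> [|_ _ [f Hf <-] [g Hg <-]].
    exists (fun=> 1) => //; rewrite wreath11 //; exact: (subgroup1 (sH i)).
  exists (fun x => f x * (g x)^-1) => //; rewrite -wreath1M -wreath1V.
  by apply: (subgroupM (sH i)) => //; apply: (subgroupV (sH i)).
- have := spine_group_genl i; rewrite spineE => Hg.
  by eexists; first exact: Hg.
- have := spine_group_genr i; rewrite spineE => Hg.
  by eexists; first exact: Hg.
- by have [g [Hg g0 _]] := spine_group_sigma_lift i; exists g.
Qed.

(** The [c] with the desired property form a subgroup [N]; by [commg_generated] it suffices that [N]
    is stable under conjugation by H_(i+1) and contains the commutators of its generators. *)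
Lemma commutator_spine_group0 i c :
  commutator_subgroup (spine_group (i + 1)%R) c ->
  commutator_subgroup (spine_group i) (at_letter (0%R : X) c).
Proof.
set D := commutator_subgroup (spine_group i).
have sD : is_subgroup D := is_subgroup_generated _.
have [_ n11] := letterN1_neq.
pose N : set (tree_aut X) := [set c | D (at_letter (0%R : X) c)].
have sN : is_subgroup N.
  apply/is_subgroupP; split=> [|x y Nx Ny]; rewrite /N /=.
    rewrite /at_letter wreath11 => [|x]; last by case: ifP.
    exact: (subgroup1 sD).
  have := subgroupM sD Nx (subgroupV sD Ny); rewrite wreath1V wreath1M.
  rewrite (@eq_wreath _ _ (fun z => if z == 0%R then x * y^-1 else 1)) // => z.
  by case: ifP => // _; rewrite invg1 mulg1.
apply: (generated_subgroup_min sN) => // _ [x Hx [y Hy <-]].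
apply: (@commg_generated _
  [set spine a (i + 1)%R; spine b (i + 1)%R; sigma] N) => //.
  (* Conjugating (c, 1, ..., 1) by a lift of [h] only involves the coordinate [h] of the lift at
     0. *)
  move=> {}c h Nc /spine_group_lift[g Hg <-].
  have := commutator_subgroupJ (sH i) Nc Hg.
  rewrite conjgE wreath1V !wreath1M.
  rewrite (@eq_wreath _ _ (fun z => if z == 0%R then c ^ g 0%R else 1)) // => z.
  by case: eqP => [->|_] //; rewrite mul1g mulVg.
have [g [Hg g0 g1]] := spine_group_sigma_lift i.
(* Off the letter 0, one of the two coordinates is always 1: the lift is trivial at 1, the spine at
   every other letter. *)
have Nsigma d : spine_group i (spine d i) -> N [~ spine d (i + 1)%R, sigma].
  rewrite /N /= => Hd; have := mem_commutator_subgroup Hd Hg.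
  rewrite spineE wreath1R.
  rewrite (@eq_wreath _ _ (fun x => if x == 0%R then
    [~ spine d (i + 1)%R, sigma] else 1)) // => z.
  case: eqP => [->|/eqP z0]; first by rewrite g0.
  case: eqP => [z1|_]; last by rewrite comm1g.
  by rewrite g1 ?commg1 // z1 eq_sym.
(* At the letter 1 both coordinates are powers of [sigma], hence commute. *)
have Nab : N [~ spine a (i + 1)%R, spine b (i + 1)%R].
  have := mem_commutator_subgroup (spine_group_genl i) (spine_group_genr i).
  rewrite /N /= (spineE a i) (spineE b i) wreath1R.
  rewrite (@eq_wreath _ _ (fun x => if x == 0%R then
    [~ spine a (i + 1)%R, spine b (i + 1)%R] else 1)) // => z.
  case: eqP => // _; case: eqP => [_|_]; last by rewrite comm1g.
  by apply/eqP/commgP; apply: commuteX2.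
have [Na Nb] := (Nsigma a (spine_group_genl i), Nsigma b (spine_group_genr i)).
have N1 : N 1 by exact: subgroup1.
move=> s t [[->|->]|->] [[->|->]|->]; rewrite ?commgg //;
  by rewrite -invg_commg; apply: (subgroupV sN).
Qed.

Lemma commutator_spine_group_wreath i (f : X -> tree_aut X) :
  (forall x, commutator_subgroup (spine_group (i + 1)%R) (f x)) ->
  commutator_subgroup (spine_group i) (wreath f 1).
Proof.
move=> Df; apply: wreath1_mem => [|x]; first exact: is_subgroup_generated.
have := commutator_spine_group0 (Df x).
move=> /(commutator_subgroupJ (sH i)).
(* Conjugation by the power of [sigma] with exponent -x, read as a natural number, moves the
   coordinate from 0 to 0 - (-x) = x. *)
move=> /(_ _ (subgroupX (- x)%R (sH i) (spine_group_sigma i))).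
by rewrite at_letterJ_sigmaX natr_Zp sub0r opprK.
Qed.

(** Induction on [n] splits off the first letter, so that the restrictions at single letters fall
    under the case of [n] and [i + 1]. *)
Lemma commutator_spine_group_level n i (g : tree_aut X) :
    (forall v, size v = n -> g v = v /\
       commutator_subgroup (spine_group (i + n%:R)%R) (restr g v)) ->
  commutator_subgroup (spine_group i) g.
Proof.
elim: n i g => [|n IHn] i g gP.
  have [_] := gP [::] erefl; rewrite addr0.
  suff -> : restr g [::] = g by [].
  by apply: tree_aut_ext => w; rewrite /= /restr_fun drop0.
have gfix x v : size v = n -> g [:: x] = [:: x] /\ restr g [:: x] v = v.
  move=> szv; have [+ _] := gP (x :: v) (congr1 S szv).
  rewrite -cat1s restrP => /eqP.
  by rewrite eqseq_cat ?size_tree_aut // => /andP[/eqP-> /eqP->].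
(* Any extension of [x] to length [n.+1] would do; it is padded with [x]. *)
have gx x : g [:: x] = [:: x].
  by have [] := gfix x (nseq n x) (size_nseq n x).
rewrite (wreath1_restr gx); apply: commutator_spine_group_wreath => x.
apply: IHn => v szv; split; first by have [] := gfix x v szv.
have [_] := gP (x :: v) (congr1 S szv); rewrite -addrA nat1r.
by rewrite -cat1s restr_cat.
Qed.

Lemma spine_group_transitive i (v w : seq X) : size v = size w ->
  exists2 g, spine_group i g & g v = w.
Proof.
elim: v w i => [|x v IHv] [|y w] i //= => [_|[szvw]].
  by exists 1 => //; exact: (subgroup1 (sH i)).
have [h /spine_group_lift[g Hg g0] hvw] := IHv w (i + 1)%R szvw.
(* Move [x] to 0, let the lift of [h] act on the tail below 0, then move 0 to [y]; powers of [sigma]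
   leave the tail alone. *)
exists (sigma ^+ y * (wreath g 1 * sigma ^+ (- x)%R)).
  by do !apply: (subgroupM (sH i)) => //; apply: (subgroupX _ (sH i));
    exact: spine_group_sigma.
rewrite !tree_autM sigmaX_cons natr_Zp subrr /= perm1 g0 hvw.
by rewrite sigmaX_cons natr_Zp add0r.
Qed.

End Spine.

(** * The exponents u and v, with starting index 1 *)

Theorem proposition13 (p : nat) (p_prime : prime p) (p_gt2 : (2 < p)%N)
    (lambda : 'Z_(p ^ 2) -> 'F_p * 'F_p) (lambda_enum : bijective lambda) :
  regular_branch (H_group lambda) (commutator_subgroup (H_group lambda)).
Proof.
have uv1 i : u_exp lambda i = 1%R \/ v_exp lambda i = 1%R.
  by rewrite /u_exp /v_exp; case: eqP; [right | left].
have -> : H_group lambda = spine_group (u_exp lambda) (v_exp lambda) 1%R by [].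
have sH := is_subgroup_generated
  [set spine (u_exp lambda) 1%R; spine (v_exp lambda) 1%R; sigma p].
split.
- by split; [exact: sH | exact: is_subgroup_generated].
- exact: commutator_subgroup_sub.
- move=> n v w; apply: spine_group_transitive => //.
  by rewrite !size_tuple.
(* After p^2 levels the index, taken modulo p^2, is again 1. *)
- exists (p ^ 2)%N; first by rewrite expn_gt0 prime_gt0.
  move=> gs Dgs g gP.
  apply: (@commutator_spine_group_level _ _ _ _ _ _ (p ^ 2)) => // v /eqP szv.
  have [gv rv] := gP (Tuple szv); split=> //.
  rewrite pchar_Zp ?addr0; last by rewrite (ltn_exp2l 0) // prime_gt1.
  by rewrite rv.
- exact: finite_index_spine_group.
Qed.
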